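(* Suppose there exist polynomials $p$ and $q$ and a constant $\gamma > 0$ such that $$\Omega(2^{\gamma n}/p(n)) \leq \chi(T^{\otimes n}) \leq O(q(n)2^{\gamma n}).$$ Then for every linear code $L\subseteq \mathbb{F}_2^m$ of block length $m$ and dimension $k < m/2$ we have $$\gamma \leq \frac{\log_2(\chi(\hat{L}))}{m - 2k}.$$
   Context: The stabilizer rank $\chi(\psi)$ of a state $\ket{\psi}$ is the minimum number $k$ of stabilizer states $\ket{\Phi_i}$ such that $\ket{\psi}=\sum_{i=1}^k c_i\ket{\Phi_i}$. Here $\ket{T} = 2^{-1/2}(\ket{0}+e^{i\pi/4}\ket{1})$ and $\ket{T^\perp} = Z\ket{T}$. For a linear space $L \subseteq \mathbb{F}_2^m$ of dimension $k$, the magic code state is $\ket{\hat{L}} = 2^{-k/2}\sum_{x \in L} \ket{\hat{x}}$, where for $x\in\mathbb{F}_2^m$, $\ket{\hat{x}} = \ket{\hat{x}_1}\otimes\cdots\otimes\ket{\hat{x}_m}$ with $\ket{\hat{0}} = \ket{T}$ and $\ket{\hat{1}} = \ket{T^\perp}$ (i.e. $x$ expanded in the magic basis $\{\ket{T},\ket{T^\perp}\}$). $\chi(\hat{L})$ denotes the stabilizer rank of $\ket{\hat{L}}$. *)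

(* Defs.v *)
From HB Require Import structures.
From mathcomp Require Import all_boot all_order all_algebra all_field.
From mathcomp Require Import boolp reals exp.
Set Implicit Arguments. Unset Strict Implicit. Unset Printing Implicit Defensive.
Import Order.TTheory GRing.Theory Num.Theory.
Local Open Scope ring_scope.

(* Computational basis labels of n qubits and n-qubit state vectors in C^(2^n). *)
Notation bits n := {ffun 'I_n -> bool}.
Notation state n := {ffun bits n -> algC}.

Definition setb n (x : bits n) (j : 'I_n) (b : bool) : bits n :=
  [ffun i => if i == j then b else x i].

Definition ket0 n : state n := [ffun x : bits n => if x == [ffun => false] then 1 else 0].

Definition gateH n (j : 'I_n) (psi : state n) : state n :=
  [ffun x : bits n => (psi (setb x j false) + (if x j then -1 else 1) * psi (setb x j true))
             / sqrtC 2].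
Definition gateS n (j : 'I_n) (psi : state n) : state n :=
  [ffun x : bits n => (if x j then 'i else 1) * psi x].
Definition gateCX n (c t : 'I_n) (psi : state n) : state n :=
  [ffun x : bits n => psi (setb x t (x t (+) x c))].

Inductive stabilizer n : state n -> Prop :=
| stab_ket0 : stabilizer (ket0 n)
| stab_H j psi : stabilizer psi -> stabilizer (gateH j psi)
| stab_S j psi : stabilizer psi -> stabilizer (gateS j psi)
| stab_CX c t psi : c != t -> stabilizer psi -> stabilizer (gateCX c t psi).

Definition stab_decomp n (psi : state n) (k : nat) : Prop :=
  exists (Phi : 'I_k -> state n) (c : 'I_k -> algC),
    (forall i, stabilizer (Phi i)) /\ psi = [ffun x : bits n => \sum_(i < k) c i * Phi i x].

Lemma stab_decomp_ex_bool n (psi : state n) :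
  (exists k, stab_decomp psi k) -> exists k, `[< stab_decomp psi k >].
Proof. by case=> k hk; exists k; apply/asboolP. Qed.

Definition stab_rank n (psi : state n) : nat :=
  match pselect (exists k, stab_decomp psi k) with
  | left h => ex_minn (stab_decomp_ex_bool h)
  | right _ => 0%N
  end.

(* e^{i pi/4} *)
Definition omega : algC := (1 + 'i) / sqrtC 2.

Definition Tpow n : state n :=
  [ffun y : bits n => \prod_(j < n) ((sqrtC 2)^-1 * (if y j then omega else 1))].

(* |x^> in the magic basis |0^>=|T>, |1^>=|T^perp>=Z|T> *)
Definition xhat m (x : 'rV['F_2]_m) : state m :=
  [ffun y : bits m => \prod_(j < m)
     ((sqrtC 2)^-1 * (if y j then (if x 0 j == 1 then - omega else omega) else 1))].

Definition Lhat m (L : {vspace 'rV['F_2]_m}) : state m :=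
  [ffun y : bits m => sqrtC 2 ^- (\dim L) * \sum_(x : 'rV['F_2]_m | x \in L) xhat x y].

(* Main.v *)
(** Write |L^> as a sum of magic-basis vectors indexed by codewords and take r copies of it: a
    sum over 2^(kr) words on rm qubits, of stabilizer rank at most chi(L^)^r.  On the magic basis the
    stabilizer bra <00| - i<11| acts as <T T| + <T^perp T^perp|, so applying it to two qubits removes
    them and keeps exactly the words that agree on them.  As long as two coordinates differ on some
    word they can be chosen (up to a Z on one of them) so that at most half of the words survive;
    after at most kr steps, hence with at least r(m - 2k) qubits left, the remaining state is
    a T^I + b T^perp^I.  Its T^perp part is cancelled by adding the image under the Clifford SX,
    so chi(T^(r(m-2k))) <= 2 chi(L^)^r.  Comparing with the lower bound on chi(T^n) as r grows
    gives the claim.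

    The fact from stabilizer theory needed here is that projecting one qubit of a stabilizer state
    on |0> yields a multiple of a stabilizer state on the others.  It follows by induction on the
    circuit from the invariant that the two halves of a stabilizer state are, up to scalars,
    a stabilizer state and its image under a Pauli operator, or one of them vanishes. *)

Require Import Defs.
From HB Require Import structures.
From mathcomp Require Import all_boot all_order all_algebra all_field.
From mathcomp Require Import boolp reals exp.
From mathcomp Require Import ring.
Set Implicit Arguments. Unset Strict Implicit. Unset Printing Implicit Defensive.
Import Order.TTheory GRing.Theory Num.Theory.
Local Open Scope ring_scope.

(** * Scalars, gates and Pauli operators *)

Notation word I := {ffun I -> bool}.
Notation amp I := {ffun {ffun I -> bool} -> algC}.

Definition rt2 : algC := (sqrtC 2)^-1.

Lemma rt2_sqr : rt2 * rt2 * 2 = 1.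
Proof. by rewrite -expr2 exprVn sqrtCK mulVf // pnatr_eq0. Qed.

Lemma rt2_exp4 : rt2 ^+ 4 * 4 = 1.
Proof.
have -> : rt2 ^+ 4 * 4 = (rt2 * rt2 * 2) * (rt2 * rt2 * 2) by ring.
by rewrite rt2_sqr mulr1.
Qed.

Lemma iMi : 'i * 'i = -1 :> algC.
Proof. by rewrite -expr2 sqrCi. Qed.

(* Qubits are labelled by an arbitrary finite type rather than by 'I_n: a qubit is then split
   off as in [option I], and tensor powers live on [I * J]. *)
Section Gates.
Variable I : finType.
Implicit Types (x a : word I) (psi chi xi : amp I) (i j l c t : I).

Definition upd x j b : word I := [ffun i => if i == j then b else x i].
Definition flip x j : word I := upd x j (~~ x j).
Definition ket a : amp I := [ffun x => if x == a then 1 else 0].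
Definition hadamard j psi : amp I :=
  [ffun x : word I => (psi (upd x j false) + (if x j then -1 else 1) * psi (upd x j true))
             / sqrtC 2].
Definition phase j psi : amp I :=
  [ffun x : word I => (if x j then 'i else 1) * psi x].
Definition cnot c t psi : amp I :=
  [ffun x : word I => psi (upd x t (x t (+) x c))].
Definition pauliX j psi : amp I := [ffun x : word I => psi (flip x j)].
Definition pauliZ j psi : amp I := [ffun x : word I => (if x j then -1 else 1) * psi x].
Definition scal (z : algC) psi : amp I := [ffun x => z * psi x].

Inductive stab : amp I -> Prop :=
| stabG_ket0 : stab (ket [ffun => false])
| stabG_H j psi : stab psi -> stab (hadamard j psi)
| stabG_S j psi : stab psi -> stab (phase j psi)
| stabG_CX c t psi : c != t -> stab psi -> stab (cnot c t psi).

Lemma updK x j : upd x j (x j) = x.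
Proof. by apply/ffunP=> i; rewrite !ffunE; case: eqP => [->|]. Qed.

Lemma flipE x j i : flip x j i = x i (+) (i == j).
Proof. by rewrite ffunE; case: eqP => [->|]; rewrite ?addbT ?addbF. Qed.

Lemma flipK x j : flip (flip x j) j = x.
Proof. by apply/ffunP=> i; rewrite !flipE addbK. Qed.

Lemma flipC x i j : flip (flip x i) j = flip (flip x j) i.
Proof. by apply/ffunP=> k; rewrite !flipE addbAC. Qed.

Lemma hadamardE j psi x : hadamard j psi x =
  rt2 * (if x j then psi (flip x j) - psi x else psi x + psi (flip x j)).
Proof.
rewrite ffunE /flip mulrC -[psi x](congr1 psi (updK x j)); congr (_ * _).
by case: (x j); rewrite /= ?mulN1r ?mul1r.
Qed.

Lemma cnotE c t psi x : cnot c t psi x = if x c then psi (flip x t) else psi x.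
Proof. by rewrite ffunE /flip; case: (x c); rewrite ?addbT // addbF updK. Qed.

Lemma phaseE j psi x : phase j psi x = (if x j then 'i else 1) * psi x.
Proof. by rewrite ffunE. Qed.

Lemma pauliXE j psi x : pauliX j psi x = psi (flip x j).
Proof. by rewrite ffunE. Qed.

Lemma pauliZE j psi x : pauliZ j psi x = (if x j then -1 else 1) * psi x.
Proof. by rewrite ffunE. Qed.

Lemma scalE z psi x : scal z psi x = z * psi x.
Proof. by rewrite ffunE. Qed.

Definition gateE :=
  (hadamardE, cnotE, phaseE, pauliXE, pauliZE, scalE, flipE, flipK, @eqxx).

Lemma pauliZ_phase j psi : pauliZ j psi = phase j (phase j psi).
Proof.
apply/ffunP=> x; rewrite !gateE mulrA.
by case: (x j); rewrite ?iMi ?mulr1.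
Qed.

Lemma pauliX_hadamard j psi : pauliX j psi = hadamard j (pauliZ j (hadamard j psi)).
Proof.
apply/ffunP=> x; rewrite !gateE.
by case: (x j) => /=; ring: rt2_sqr.
Qed.

Lemma stab_pauliZ j psi : stab psi -> stab (pauliZ j psi).
Proof. by move=> s; rewrite pauliZ_phase; do 2!apply: stabG_S. Qed.

Lemma stab_pauliX j psi : stab psi -> stab (pauliX j psi).
Proof.
by move=> s; rewrite pauliX_hadamard; apply/stabG_H/stab_pauliZ/stabG_H.
Qed.

(** Hadamards on both qubits exchange control and target. This turns a gate that targets the
    split-off qubit into one that it controls. *)
Lemma cnot_swap c t psi : c != t ->
  cnot c t psi = hadamard c (hadamard t (cnot t c (hadamard c (hadamard t psi)))).
Proof.
move=> ct; apply/ffunP=> x; rewrite !gateE.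
have E y : flip (flip y t) c = flip (flip y c) t by exact: flipC.
rewrite (negbTE ct) eq_sym (negbTE ct) !addbF !addbT !(E, flipK).
by case: (x c); case: (x t) => /=; rewrite ?(E, flipK); ring: rt2_exp4.
Qed.

Section Commute.
Variable psi : amp I.

(** Clifford gates normalise the Pauli group: this lemma and the five after it tabulate how X and Z
    move past each gate. *)
Lemma XH l j : pauliX l (hadamard j psi) =
  hadamard j (if l == j then pauliZ l psi else pauliX l psi).
Proof.
apply/ffunP=> x; case: eqVneq => [->|lj]; rewrite !gateE ?(flipC x l j).
  by case: (x j) => /=; ring.
by rewrite eq_sym (negbTE lj) addbF.
Qed.

Lemma ZH l j : pauliZ l (hadamard j psi) =
  hadamard j (if l == j then pauliX l psi else pauliZ l psi).
Proof.
apply/ffunP=> x; case: eqVneq => [->|lj]; rewrite !gateE.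
  by case: (x j) => /=; ring.
by rewrite (negbTE lj) addbF; case: (x l); case: (x j); ring.
Qed.

(** The phase -i = i^3 arising here is the reason to close Pauli orbits under powers of ['i]. *)
Lemma XS l j : pauliX l (phase j psi) =
  phase j (if l == j then scal (- 'i) (pauliX l (pauliZ l psi)) else pauliX l psi).
Proof.
apply/ffunP=> x; case: eqVneq => [->|lj]; rewrite !gateE.
  by case: (x j) => /=; ring: iMi.
by rewrite eq_sym (negbTE lj) addbF.
Qed.

Lemma ZS l j : pauliZ l (phase j psi) = phase j (pauliZ l psi).
Proof. by apply/ffunP=> x; rewrite !gateE mulrCA. Qed.

Lemma XCX l c t : c != t -> pauliX l (cnot c t psi) =
  cnot c t (if l == c then pauliX c (pauliX t psi) else pauliX l psi).
Proof.
move=> ct; apply/ffunP=> x; case: eqVneq => [->|lc]; rewrite !gateE.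
  by rewrite addbT; case: (x c) => //=; rewrite (flipC x t c) flipK.
by rewrite eq_sym (negbTE lc) addbF ?(flipC x l t).
Qed.

Lemma ZCX l c t : c != t -> pauliZ l (cnot c t psi) =
  cnot c t (if l == t then pauliZ c (pauliZ t psi) else pauliZ l psi).
Proof.
move=> ct; apply/ffunP=> x; case: eqVneq => [->|lt]; rewrite !gateE.
  by rewrite (negbTE ct) addbF; case: (x c); case: (x t) => /=; ring.
by rewrite (negbTE lt) addbF; case: (x c).
Qed.

Lemma scalH z j : scal z (hadamard j psi) = hadamard j (scal z psi).
Proof. by apply/ffunP=> x; rewrite !gateE; case: (x j) => /=; ring. Qed.

Lemma scalS z j : scal z (phase j psi) = phase j (scal z psi).
Proof. by apply/ffunP=> x; rewrite !gateE; ring. Qed.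

Lemma scalCX z c t : scal z (cnot c t psi) = cnot c t (scal z psi).
Proof. by apply/ffunP=> x; rewrite !gateE; case: (x c). Qed.

Lemma scalM z w : scal z (scal w psi) = scal (z * w) psi.
Proof. by apply/ffunP=> x; rewrite !gateE mulrA. Qed.

Lemma scal1 : scal 1 psi = psi.
Proof. by apply/ffunP=> x; rewrite !gateE mul1r. Qed.

Lemma scalX z j : pauliX j (scal z psi) = scal z (pauliX j psi).
Proof. by apply/ffunP=> x; rewrite !gateE. Qed.

Lemma scalZ z j : pauliZ j (scal z psi) = scal z (pauliZ j psi).
Proof. by apply/ffunP=> x; rewrite !gateE mulrCA. Qed.

End Commute.

(** * Pairs of states related by a Pauli operator *)

Definition padd (chi xi : amp I) : amp I := [ffun x => chi x + xi x].

Lemma paddE chi xi x : padd chi xi x = chi x + xi x.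
Proof. by rewrite ffunE. Qed.

Lemma paddH j chi xi : hadamard j (padd chi xi) = padd (hadamard j chi) (hadamard j xi).
Proof. by apply/ffunP=> x; rewrite !(gateE, paddE); case: (x j); ring. Qed.

Lemma paddS j chi xi : phase j (padd chi xi) = padd (phase j chi) (phase j xi).
Proof. by apply/ffunP=> x; rewrite !(gateE, paddE); case: (x j); ring. Qed.

Lemma paddCX c t chi xi : cnot c t (padd chi xi) = padd (cnot c t chi) (cnot c t xi).
Proof. by apply/ffunP=> x; rewrite !(gateE, paddE); case: (x c). Qed.

Lemma scalD z chi xi : scal z (padd chi xi) = padd (scal z chi) (scal z xi).
Proof. by apply/ffunP=> x; rewrite !(gateE, paddE) mulrDr. Qed.

(* [spair xi xi'] relates a stabilizer state to its image under a Pauli operator. *)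
Inductive spair : amp I -> amp I -> Prop :=
| spair_ket0 s a : spair (ket [ffun => false]) (scal ('i ^+ s) (ket a))
| spair_H j chi xi : spair chi xi -> spair (hadamard j chi) (hadamard j xi)
| spair_S j chi xi : spair chi xi -> spair (phase j chi) (phase j xi)
| spair_CX c t chi xi : c != t -> spair chi xi -> spair (cnot c t chi) (cnot c t xi).

(** The orbit of [xi] under the Pauli group, presented by generators so that they can be moved past
    a gate one at a time. *)
Inductive pauli_orbit xi : amp I -> Prop :=
| orbit_refl : pauli_orbit xi xi
| orbit_X l chi : pauli_orbit xi chi -> pauli_orbit xi (pauliX l chi)
| orbit_Z l chi : pauli_orbit xi chi -> pauli_orbit xi (pauliZ l chi)
| orbit_i s chi : pauli_orbit xi chi -> pauli_orbit xi (scal ('i ^+ s) chi).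

Lemma expi_2 : 'i ^+ 2 = -1 :> algC. Proof. exact: sqrCi. Qed.

Lemma expi_3 : 'i ^+ 3 = - 'i :> algC. Proof. by rewrite exprS sqrCi mulrN1. Qed.

Lemma ketE a x : ket a x = if x == a then 1 else 0.
Proof. by rewrite ffunE. Qed.

Lemma pauliX_ket l a : pauliX l (ket a) = ket (flip a l).
Proof.
apply/ffunP=> x; rewrite pauliXE !ketE; congr (if _ then _ else _).
by apply/eqP/eqP=> [<-|->]; rewrite flipK.
Qed.

Lemma pauliZ_ket l a : pauliZ l (ket a) = scal ('i ^+ (if a l then 2 else 0)) (ket a).
Proof.
apply/ffunP=> x; rewrite pauliZE scalE !ketE; case: eqP => [->|]; rewrite ?mulr0 ?mulr1 //.
by case: (a l); rewrite ?expi_2.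
Qed.

Lemma orbit_ket s a psi : pauli_orbit (scal ('i ^+ s) (ket a)) psi ->
  exists r b, psi = scal ('i ^+ r) (ket b).
Proof.
elim=> [|l chi _ [r [b ->]]|l chi _ [r [b ->]]|t chi _ [r [b ->]]].
- by exists s, a.
- by exists r, (flip b l); rewrite scalX pauliX_ket.
- by eexists _, b; rewrite scalZ pauliZ_ket scalM -exprD.
- by eexists _, b; rewrite scalM -exprD.
Qed.

Lemma orbit_H j xi psi : pauli_orbit (hadamard j xi) psi ->
  exists2 chi, psi = hadamard j chi & pauli_orbit xi chi.
Proof.
elim=> [|l ? _ [chi -> o]|l ? _ [chi -> o]|s ? _ [chi -> o]].
- by exists xi => //; apply: orbit_refl.
- by eexists; first exact: XH; case: eqP => _; constructor.
- by eexists; first exact: ZH; case: eqP => _; constructor.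
- by eexists; first exact: scalH; constructor.
Qed.

Lemma orbit_S j xi psi : pauli_orbit (phase j xi) psi ->
  exists2 chi, psi = phase j chi & pauli_orbit xi chi.
Proof.
elim=> [|l ? _ [chi -> o]|l ? _ [chi -> o]|s ? _ [chi -> o]].
- by exists xi => //; apply: orbit_refl.
- by eexists; first exact: XS; rewrite -expi_3; case: eqP => _; do !constructor.
- by eexists; first exact: ZS; constructor.
- by eexists; first exact: scalS; constructor.
Qed.

Lemma orbit_CX c t xi psi : c != t -> pauli_orbit (cnot c t xi) psi ->
  exists2 chi, psi = cnot c t chi & pauli_orbit xi chi.
Proof.
move=> ct; elim=> [|l ? _ [chi -> o]|l ? _ [chi -> o]|s ? _ [chi -> o]].
- by exists xi => //; apply: orbit_refl.
- by eexists; first exact: XCX; case: eqP => _; do !constructor.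
- by eexists; first exact: ZCX; case: eqP => _; do !constructor.
- by eexists; first exact: scalCX; constructor.
Qed.

(** A Pauli operator is pulled back through the circuit gate by gate down to the basis state, where
    it changes only the label and the power of i. *)
Lemma spair_orbit chi xi psi : spair chi xi -> pauli_orbit xi psi -> spair chi psi.
Proof.
move=> sp; elim: sp psi => [s a|j {}chi {}xi _ IH|j {}chi {}xi _ IH|c t {}chi {}xi ct _ IH] psi.
- by case/orbit_ket=> r [b ->]; apply: spair_ket0.
- by case/orbit_H=> psi' -> /IH; apply: spair_H.
- by case/orbit_S=> psi' -> /IH; apply: spair_S.
- by case/(orbit_CX ct)=> psi' -> /IH; apply: spair_CX.
Qed.

Lemma spair_X l chi xi : spair chi xi -> spair chi (pauliX l xi).
Proof. by move/spair_orbit; apply; do !constructor. Qed.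

Lemma spair_Z l chi xi : spair chi xi -> spair chi (pauliZ l xi).
Proof. by move/spair_orbit; apply; do !constructor. Qed.

Lemma spair_scal s chi xi : spair chi xi -> spair chi (scal ('i ^+ s) xi).
Proof. by move/spair_orbit; apply; do !constructor. Qed.

Lemma spairxx psi : stab psi -> spair psi psi.
Proof.
elim=> [|j chi _|j chi _|c t chi ct _]; try by constructor.
by rewrite -{2}[ket _]scal1; apply: (spair_ket0 0).
Qed.

Lemma spair_stab chi xi : spair chi xi -> stab chi.
Proof. by elim=> *; constructor. Qed.

(* The states of the form |0> phi0 + |1> phi1, one qubit split off, that arise
   from stabilizer states, up to a scalar. *)
Definition halves (phi0 phi1 : amp I) : Prop :=
  exists alpha beta xi xi', [/\ spair xi xi', phi0 = scal alpha xi, phi1 = scal beta xi' &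
    alpha = beta \/ xi = xi' /\ (alpha = 0 \/ beta = 0)].

(** A gate away from the split-off qubit acts alike on both halves, so the scalars and the Pauli
    relation carry over. *)
Lemma halves_H j phi0 phi1 :
  halves phi0 phi1 -> halves (hadamard j phi0) (hadamard j phi1).
Proof.
move=> [a [b [xi [xi' [sp -> -> ab]]]]].
exists a, b, (hadamard j xi), (hadamard j xi'); split; rewrite ?scalH //.
  exact: spair_H.
by case: ab => [|[->]]; [left|right].
Qed.

Lemma halves_S j phi0 phi1 :
  halves phi0 phi1 -> halves (phase j phi0) (phase j phi1).
Proof.
move=> [a [b [xi [xi' [sp -> -> ab]]]]].
exists a, b, (phase j xi), (phase j xi'); split; rewrite ?scalS //.
  exact: spair_S.
by case: ab => [|[->]]; [left|right].
Qed.

Lemma halves_CX c t phi0 phi1 : c != t ->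
  halves phi0 phi1 -> halves (cnot c t phi0) (cnot c t phi1).
Proof.
move=> ct [a [b [xi [xi' [sp -> -> ab]]]]].
exists a, b, (cnot c t xi), (cnot c t xi'); split; rewrite ?scalCX //.
  exact: spair_CX.
by case: ab => [|[->]]; [left|right].
Qed.

Lemma halves_scal z phi0 phi1 :
  halves phi0 phi1 -> halves (scal z phi0) (scal z phi1).
Proof.
move=> [a [b [xi [xi' [sp -> -> ab]]]]].
exists (z * a), (z * b), xi, xi'; split; rewrite ?scalM //.
by case: ab => [->|[-> [->|->]]]; rewrite ?mulr0; [left|right..]; split=> //; [left|right].
Qed.

(** * GHZ states and gates on the split-off qubit *)

Definition ghz s a : amp I := scal rt2 (padd (ket [ffun => false]) (scal ('i ^+ s) (ket a))).

Lemma cnot_ket c t a : c != t -> cnot c t (ket a) = ket (if a c then flip a t else a).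
Proof.
move=> ct; apply/ffunP=> x; rewrite cnotE !ketE.
have fE y : flip y t c = y c by rewrite flipE (negbTE ct) addbF.
have ne (z y : word I) : z c != y c -> (z == y) = false by move=> n; apply: contraNF n => /eqP->.
have fx : (flip x t == a) = (x == flip a t).
  by apply/eqP/eqP=> [<-|->]; rewrite flipK.
case xc: (x c); case ac: (a c) => //; rewrite ?fx // !ne ?fE ?xc ?ac //.
Qed.

(** A CNOT controlled by [l] fixes the |0...0> branch and flips [t] in the other one. *)
Lemma stab_ghz_flip s a l t : a l -> t != l -> stab (ghz s a) -> stab (ghz s (flip a t)).
Proof.
move=> al tl sa; have lt : l != t by rewrite eq_sym.
have := stabG_CX lt sa.
by rewrite /ghz -scalCX paddCX -scalCX !cnot_ket // al ffunE.
Qed.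

(** A Hadamard on [l] gives [s = 0]; each phase gate on [l] adds a factor i. *)
Lemma stab_ghz_unit s l : stab (ghz s [ffun i => i == l]).
Proof.
elim: s => [|s IH].
  have -> : ghz 0 [ffun i => i == l] = hadamard l (ket [ffun => false]).
    apply/ffunP=> x; rewrite !(gateE, paddE) mul1r !ketE.
    have -> : (x == [ffun i => i == l]) = (flip x l == [ffun => false]).
      by apply/eqP/eqP=> [->|/ffunP e]; apply/ffunP=> i; rewrite ?flipE ?ffunE ?addbb //;
        have := e i; rewrite flipE ffunE; case: (x i); case: (i == l).
    case xl: (x l) => //; congr (_ * _).
    have -> : (x == [ffun => false]) = false by apply/eqP=> e; rewrite e ffunE in xl.
    by rewrite add0r subr0.
  exact/stabG_H/stabG_ket0.
have -> : ghz s.+1 [ffun i => i == l] = phase l (ghz s [ffun i => i == l]).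
  apply/ffunP=> x; rewrite !(gateE, paddE) !ketE exprS.
  case: (eqVneq x [ffun i => i == l]) => [->|_].
    case: eqP => [/ffunP/(_ l)|_]; first by rewrite !ffunE eqxx.
    by rewrite !ffunE eqxx; ring.
  by case: eqP => [->|_]; rewrite ?ffunE; ring.
exact: stabG_S.
Qed.

(** Starting from the unit label at [l], the coordinates are corrected to those of [a] one by one
    with CNOTs controlled by [l]. *)
Lemma stab_ghz s a l : a l -> stab (ghz s a).
Proof.
move=> al.
suff st (ts : seq I) : stab (ghz s [ffun i => if i \in ts then a i else i == l]).
  have := st (enum I); congr (stab (ghz _ _)).
  by apply/ffunP=> i; rewrite ffunE mem_enum.
elim: ts => [|t ts IH].
  suff -> : [ffun i => if i \in [::] then a i else i == l] = [ffun i => i == l].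
    exact: stab_ghz_unit.
  by apply/ffunP=> i; rewrite !ffunE.
set b := [ffun i => _] in IH; set b' := [ffun i => _].
have bl : b l by rewrite ffunE al eqxx if_same.
case: (eqVneq (b t) (a t)) => [bt|bt].
  suff -> : b' = b by [].
  apply/ffunP=> i; rewrite [LHS]ffunE inE.
  by case: eqP => [->|_] /=; [rewrite bt|rewrite ffunE].
have tl : t != l by apply: contraNneq bt => ->; rewrite bl al.
suff -> : b' = flip b t by apply: stab_ghz_flip bl tl IH.
apply/ffunP=> i.
rewrite flipE [LHS]ffunE inE; case: eqP => [->|_] /=; last by rewrite addbF ffunE.
by case: (b t) (a t) bt => [] [].
Qed.

(** For zero [a] both combinations are multiples of |0...0>, by 1 + i^s and 1 - i^s. Otherwise they
    are a multiple of a GHZ state and its image under Z on a qubit where [a] is 1. *)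
Lemma halves_pm_ket0 s a :
  let k0 := ket [ffun => false] in let ka := scal ('i ^+ s) (ket a) in
  halves (padd k0 ka) (padd k0 (scal (-1) ka)).
Proof.
move=> k0 ka; case: (eqVneq a [ffun => false]) => [a0|/eqP an0].
  have -> : padd k0 ka = scal (1 + 'i ^+ s) k0.
    by apply/ffunP=> x; rewrite paddE !scalE a0; ring.
  have -> : padd k0 (scal (-1) ka) = scal (1 - 'i ^+ s) k0.
    by apply/ffunP=> x; rewrite paddE !scalE a0; ring.
  have sp : spair k0 k0 by apply/spairxx/stabG_ket0.
  (* By cases on s mod 4: for even s one scalar vanishes, for odd s their quotient is a power of
     i. *)
  have : (1 + 'i ^+ s == 0 :> algC) || (1 - 'i ^+ s == 0 :> algC) ||
      [exists r : 'I_4, 1 - 'i ^+ s == (1 + 'i ^+ s) * 'i ^+ r :> algC].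
    have -> : 'i ^+ s = 'i ^+ (s %% 4) :> algC.
      rewrite {1}(divn_eq s 4) exprD mulnC exprM (_ : 'i ^+ 4 = 1) ?expr1n ?mul1r //.
      by rewrite (exprM _ 2 2) sqrCi sqrrN expr1n.
    have := ltn_pmod s (isT : 0 < 4)%N; case: (s %% 4)%N => [|[|[|[|//]]]] _.
    - by rewrite expr0 subrr eqxx orbT.
    - apply/orP; right; apply/existsP; exists (inord 3); rewrite inordK // expi_3 expr1.
      by apply/eqP; ring: iMi.
    - by rewrite expi_2 subrr eqxx.
    - apply/orP; right; apply/existsP; exists (inord 1); rewrite inordK // expi_3 expr1.
      by apply/eqP; ring: iMi.
  case/orP=> [/orP[]/eqP->|/existsP[r /eqP->]].
  - by exists 0, (1 - 'i ^+ s), k0, k0; split=> //; right; split=> //; left.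
  - by exists (1 + 'i ^+ s), 0, k0, k0; split=> //; right; split=> //; right.
  - exists (1 + 'i ^+ s), (1 + 'i ^+ s), k0, (scal ('i ^+ r) k0); split; rewrite ?scalM //.
      exact: spair_scal.
    by left.
have [l al] : exists l, a l.
  apply/existsP; apply: contra_notT an0; rewrite negb_exists => /forallP an.
  by apply/ffunP=> i; rewrite ffunE (negbTE (an i)).
have rt2E : sqrtC 2 * rt2 = 1 by rewrite /rt2 mulfV // sqrtC_eq0 pnatr_eq0.
have E : padd k0 ka = scal (sqrtC 2) (ghz s a) by rewrite scalM rt2E scal1.
exists (sqrtC 2), (sqrtC 2), (ghz s a), (pauliZ l (ghz s a)); split=> //; last by left.
  by apply/spair_Z/spairxx/stab_ghz/al.
apply/ffunP=> x; rewrite !(gateE, paddE, ketE).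
transitivity (sqrtC 2 * rt2 * ((if x == [ffun=> false] then 1 else 0) +
   -1 * ('i ^+ s * (if x == a then 1 else 0)))) ; first by rewrite rt2E mul1r.
case: (eqVneq x a) => [->|_].
  by case: eqP => [/an0//|_]; rewrite al; ring.
by case: eqP => [->|_]; rewrite ?ffunE; ring.
Qed.

(** By linearity the circuit that builds the pair acts on the sum and on the difference, which
    reduces the claim to basis states. *)
Lemma halves_pm chi xi : spair chi xi -> halves (padd chi xi) (padd chi (scal (-1) xi)).
Proof.
elim=> [s a|j {}chi {}xi _ IH|j {}chi {}xi _ IH|c t {}chi {}xi ct _ IH].
- exact: halves_pm_ket0.
- by rewrite scalH -!paddH; apply: halves_H.
- by rewrite scalS -!paddS; apply: halves_S.
- by rewrite scalCX -!paddCX; apply: halves_CX.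
Qed.

Lemma halves_hadamard phi0 phi1 : halves phi0 phi1 ->
  halves (scal rt2 (padd phi0 phi1)) (scal rt2 (padd phi0 (scal (-1) phi1))).
Proof.
move=> [a [b [xi [xi' [sp -> -> [<-|[<- ab]]]]]]]; apply: halves_scal.
  by rewrite -scalD scalM mulN1r -mulrN1 -scalM -scalD; apply/halves_scal/halves_pm.
have sxx := spairxx (spair_stab sp).
(* When one half vanishes, the Hadamard makes the two halves equal up to sign. *)
case: ab => ->.
  exists b, b, xi, (scal ('i ^+ 2) xi); split; last by left.
  - exact: spair_scal.
  - by apply/ffunP=> x; rewrite paddE !scalE mul0r add0r.
  - by apply/ffunP=> x; rewrite paddE !scalE mul0r add0r expi_2; ring.
exists a, a, xi, xi; split=> //; last by left.
- by apply/ffunP=> x; rewrite paddE !scalE; ring.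
- by apply/ffunP=> x; rewrite paddE !scalE; ring.
Qed.

Lemma halves_phase phi0 phi1 : halves phi0 phi1 -> halves phi0 (scal 'i phi1).
Proof.
move=> [a [b [xi [xi' [sp -> -> [<-|[<- ab]]]]]]].
  exists a, a, xi, (scal ('i ^+ 1) xi'); split=> //; last by left.
    exact: spair_scal.
  by rewrite expr1 !scalM mulrC.
have sxx := spairxx (spair_stab sp).
exists a, ('i * b), xi, xi; split; rewrite ?scalM //; right; split=> //.
by case: ab => ->; rewrite ?mulr0; [left|right].
Qed.

(** The effect on the halves of a CNOT controlled by the split-off qubit. *)
Lemma halves_pauliX l phi0 phi1 : halves phi0 phi1 -> halves phi0 (pauliX l phi1).
Proof.
move=> [a [b [xi [xi' [sp -> -> [<-|[<- [->|->]]]]]]]].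
- exists a, a, xi, (pauliX l xi'); split; rewrite ?scalX //; last by left.
  exact: spair_X.
(* The first half is zero, so the common state may be replaced by its image under X. *)
- exists 0, b, (pauliX l xi), (pauliX l xi); split; rewrite ?scalX //.
  + exact/spairxx/stab_pauliX/(spair_stab sp).
  + by apply/ffunP=> x; rewrite !scalE !mul0r.
  + by right; split=> //; left.
- exists a, 0, xi, xi; split; rewrite ?scalX //.
  + exact/spairxx/(spair_stab sp).
  + by apply/ffunP=> x; rewrite !scalE !mul0r.
  + by right; split=> //; right.
Qed.

End Gates.

(** * Projecting out a qubit *)

Section SplitQubit.
Variable I : finType.
Implicit Types (x : word I) (phi : amp (option I)).

Definition ext b x : word (option I) := [ffun o => if o is Some i then x i else b].
Definition half b phi : amp I := [ffun x => phi (ext b x)].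

Lemma halfE b phi x : half b phi x = phi (ext b x).
Proof. by rewrite ffunE. Qed.

Lemma ext_None b x : ext b x None = b.
Proof. by rewrite ffunE. Qed.

Lemma ext_Some b x i : ext b x (Some i) = x i.
Proof. by rewrite ffunE. Qed.

Lemma flip_ext_None b x : flip (ext b x) None = ext (~~ b) x.
Proof. by apply/ffunP=> [[i|]]; rewrite flipE !ffunE //= ?addbF ?addbT. Qed.

Lemma flip_ext_Some b x j : flip (ext b x) (Some j) = ext b (flip x j).
Proof.
apply/ffunP=> [[i|]]; first by rewrite flipE !ext_Some flipE.
by rewrite flipE !ext_None addbF.
Qed.

Definition extE := (halfE, ext_None, ext_Some, flip_ext_None, flip_ext_Some).

Local Notation split_ok phi := (halves (half false phi) (half true phi)).

Lemma split_hadamard j phi : split_ok phi -> split_ok (hadamard j phi).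
Proof.
case: j => [j|] h.
  have E b : half b (hadamard (Some j) phi) = hadamard j (half b phi).
    by apply/ffunP=> x; rewrite !(gateE, extE).
  by rewrite !E; apply: halves_H.
have := halves_hadamard h; congr halves; apply/ffunP=> x.
  by rewrite !(gateE, paddE, extE).
by rewrite !(gateE, paddE, extE); ring.
Qed.

Lemma split_phase j phi : split_ok phi -> split_ok (phase j phi).
Proof.
case: j => [j|] h.
  have E b : half b (phase (Some j) phi) = phase j (half b phi).
    by apply/ffunP=> x; rewrite !(gateE, extE).
  by rewrite !E; apply: halves_S.
have := halves_phase h; congr halves; apply/ffunP=> x;
  by rewrite !(gateE, extE) ?mul1r.
Qed.

Lemma split_cnot c t phi : c != t -> split_ok phi -> split_ok (cnot c t phi).
Proof.
have fromNone s psi : split_ok psi -> split_ok (cnot None (Some s) psi).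
  move=> h; have := halves_pauliX s h; congr halves; apply/ffunP=> x;
  by rewrite !(gateE, extE).
case: c t => [c|] [t|] // ct h; last exact: fromNone.
  have E b : half b (cnot (Some c) (Some t) phi) = cnot c t (half b phi).
    by apply/ffunP=> x; rewrite !(gateE, extE).
  by rewrite !E; apply: halves_CX.
rewrite cnot_swap //; do 2!apply: split_hadamard.
by apply: fromNone; do 2!apply: split_hadamard.
Qed.

Lemma stab_split phi : stab phi -> split_ok phi.
Proof.
elim=> [|j psi _|j psi _|c t psi ct _].
- exists 1, 0, (ket [ffun => false]), (ket [ffun => false]); split.
  + exact/spairxx/stabG_ket0.
  + apply/ffunP=> x; rewrite scal1 halfE !ketE; congr (if _ then _ else _).
    apply/eqP/eqP=> [/ffunP e|->]; apply/ffunP=> i.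
      by have := e (Some i); rewrite !ffunE.
    by case: i => [i|]; rewrite !ffunE.
  + apply/ffunP=> x; rewrite scalE mul0r halfE ketE.
    by case: eqP => // /ffunP/(_ None); rewrite !ffunE.
  + by right; split=> //; right.
- exact: split_hadamard.
- exact: split_phase.
- exact: split_cnot.
Qed.

Lemma stab_half phi : stab phi ->
  exists z xi, stab xi /\ half false phi = scal z xi.
Proof.
move=> /stab_split[a [b [xi [xi' [sp -> _ _]]]]].
by exists a, xi; split=> //; apply: spair_stab sp.
Qed.

End SplitQubit.

(** * Upper bounds on the stabilizer rank *)

(** Coefficients may vanish and states may repeat, so this expresses rank at most [k]. *)
Definition rank_le (I : finType) (psi : amp I) k : Prop :=
  exists (Phi : 'I_k -> amp I) (c : 'I_k -> algC),
    (forall i, stab (Phi i)) /\ psi = [ffun x : word I => \sum_(i < k) c i * Phi i x].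

Section RankLe.
Variable I : finType.
Implicit Types psi chi : amp I.

(** Lets sums be indexed by a sum type, for addition, or by a function space, for tensor powers. *)
Lemma rank_le_fin (J : finType) (Phi : J -> amp I) (c : J -> algC) psi :
  (forall j, stab (Phi j)) -> (forall x, psi x = \sum_j c j * Phi j x) ->
  rank_le psi #|J|.
Proof.
move=> sP E; exists (Phi \o enum_val), (c \o enum_val); split=> [i|]; first exact: sP.
by apply/ffunP=> x; rewrite ffunE E (reindex _ (onW_bij _ (@enum_val_bij J))).
Qed.

Lemma rank_le_add psi chi k l : rank_le psi k -> rank_le chi l -> rank_le (padd psi chi) (k + l).
Proof.
move=> [P [c [sP eP]]] [Q [d [sQ eQ]]].
have -> : (k + l)%N = #|{: 'I_k + 'I_l}| by rewrite card_sum !card_ord.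
apply: (@rank_le_fin _ (fun s => match s with inl i => P i | inr j => Q j end)
                       (fun s => match s with inl i => c i | inr j => d j end)).
  by case.
by move=> x; rewrite paddE eP eQ !ffunE big_sumType.
Qed.

(** The map is applied term by term and each scalar [z] is absorbed into a coefficient. Projections
    are covered too, with [z] possibly zero. *)
Lemma rank_le_linear (J : finType) (F : amp I -> amp J) psi k :
  (forall chi xi, F (padd chi xi) = padd (F chi) (F xi)) ->
  (forall z chi, F (scal z chi) = scal z (F chi)) ->
  (forall chi, stab chi -> exists z xi, stab xi /\ F chi = scal z xi) ->
  rank_le psi k -> rank_le (F psi) k.
Proof.
move=> FD FZ Fs [P [c [sP ->]]].
have /boolp.choice[w Fw] i : exists zx : algC * amp J, stab zx.2 /\ F (P i) = scal zx.1 zx.2.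
  by have [z [xi h]] := Fs _ (sP i); exists (z, xi).
exists (fun i => (w i).2), (fun i => c i * (w i).1); split=> [i|]; first by case: (Fw i).
suff -> : F [ffun x => \sum_(i < k) c i * P i x] = [ffun x => \sum_(i < k) c i * F (P i) x].
  apply/ffunP=> y; rewrite !ffunE; apply: eq_bigr => i _.
  by case: (Fw i) => _ ->; rewrite scalE mulrA.
(* Two-term linearity is extended to [k] terms; the empty sum is written as 0 times a ket. *)
elim: k P c {sP w Fw} => [|k IH] P c.
  have -> : [ffun x => \sum_(i < 0) c i * P i x] = scal 0 (ket [ffun => false]).
    by apply/ffunP=> x; rewrite ffunE big_ord0 scalE mul0r.
  by rewrite FZ; apply/ffunP=> y; rewrite scalE mul0r ffunE big_ord0.
have -> : [ffun x => \sum_(i < k.+1) c i * P i x] =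
   padd (scal (c ord0) (P ord0)) [ffun x => \sum_(i < k) c (lift ord0 i) * P (lift ord0 i) x].
  by apply/ffunP=> x; rewrite paddE scalE !ffunE big_ord_recl.
rewrite FD FZ IH; apply/ffunP=> y; rewrite paddE scalE !ffunE big_ord_recl.
by [].
Qed.

Lemma rank_le_stab psi k (F : amp I -> amp I) :
  (forall chi xi, F (padd chi xi) = padd (F chi) (F xi)) ->
  (forall z chi, F (scal z chi) = scal z (F chi)) ->
  (forall chi, stab chi -> stab (F chi)) -> rank_le psi k -> rank_le (F psi) k.
Proof.
move=> FD FZ Fs; apply: rank_le_linear => // chi s.
by exists 1, (F chi); rewrite scal1; split=> //; apply: Fs.
Qed.

Lemma rank_le_H j psi k : rank_le psi k -> rank_le (hadamard j psi) k.
Proof.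
apply: (@rank_le_stab _ _ (hadamard j)) => *; rewrite ?paddH ?scalH //.
exact: stabG_H.
Qed.

Lemma rank_le_S j psi k : rank_le psi k -> rank_le (phase j psi) k.
Proof.
apply: (@rank_le_stab _ _ (phase j)) => *; rewrite ?paddS ?scalS //.
exact: stabG_S.
Qed.

Lemma rank_le_CX c t psi k : c != t -> rank_le psi k -> rank_le (cnot c t psi) k.
Proof.
move=> ct; apply: (@rank_le_stab _ _ (cnot c t)) => *; rewrite ?paddCX ?scalCX //.
exact: stabG_CX.
Qed.

Lemma rank_le_Z j psi k : rank_le psi k -> rank_le (pauliZ j psi) k.
Proof. by move=> h; rewrite pauliZ_phase; do 2!apply: rank_le_S. Qed.

Lemma rank_le_X j psi k : rank_le psi k -> rank_le (pauliX j psi) k.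
Proof.
by move=> h; rewrite pauliX_hadamard; apply/rank_le_H/rank_le_Z/rank_le_H.
Qed.

Lemma rank_le_scal z psi k : rank_le psi k -> rank_le (scal z psi) k.
Proof.
move=> [P [c [sP ->]]]; exists P, (fun i => z * c i); split=> //.
by apply/ffunP=> x; rewrite scalE !ffunE mulr_sumr; apply: eq_bigr => i _; rewrite mulrA.
Qed.

(** Pauli X operators, one for each 1 of [a], take |0...0> to |a>. *)
Lemma stab_ket (a : word I) : stab (ket a).
Proof.
suff st (s : seq I) : stab (ket [ffun i => (i \in s) && a i]).
  suff -> : a = [ffun i => (i \in enum I) && a i] by [].
  by apply/ffunP=> i; rewrite ffunE mem_enum.
elim: s => [|j s IH].
  suff -> : [ffun i => (i \in [::]) && a i] = [ffun => false] by apply: stabG_ket0.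
  by apply/ffunP=> i; rewrite !ffunE.
set b := [ffun i => _] in IH; set b' := [ffun i => _].
case: (eqVneq (b j) (a j)) => [e|ne].
  suff -> : b' = b by [].
  apply/ffunP=> i; rewrite [LHS]ffunE inE; case: eqP => [->|_] /=; first by rewrite e.
  by rewrite ffunE.
suff -> : b' = flip b j by rewrite -pauliX_ket; apply: stab_pauliX.
apply/ffunP=> i; rewrite flipE [LHS]ffunE inE; case: eqP => [->|_] /=.
  by case: (b j) (a j) ne => [] [].
by rewrite addbF ffunE.
Qed.

(** The expansion in the computational basis; it excludes the default branch of [stab_rank]. *)
Lemma rank_le_finite psi : exists k, rank_le psi k.
Proof.
exists #|{: word I}|; apply: (@rank_le_fin {ffun I -> bool} (@ket I) (fun a => psi a)) => [a|x].
  exact: stab_ket.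
rewrite (bigD1 x) //= ketE eqxx mulr1 big1 ?addr0 // => a ne.
by rewrite ketE eq_sym (negbTE ne) mulr0.
Qed.

End RankLe.

Lemma rank_le_half (I : finType) (phi : amp (option I)) k :
  rank_le phi k -> rank_le (half false phi) k.
Proof.
apply: rank_le_linear => [chi xi|z chi|chi]; last exact: stab_half.
  by apply/ffunP=> x; rewrite paddE !halfE paddE.
by apply/ffunP=> x; rewrite scalE !halfE scalE.
Qed.

(** * Renaming the qubits *)

Section Relabel.
Variables (I J : finType) (f : I -> J) (g : J -> I).
Hypotheses (fK : cancel f g) (gK : cancel g f).

Definition relabel (psi : amp I) : amp J := [ffun y : word J => psi [ffun i => y (f i)]].

Lemma relabelE psi (y : word J) : relabel psi y = psi [ffun i => y (f i)].
Proof. by rewrite ffunE. Qed.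

Lemma flip_relabel (y : word J) j :
  [ffun i => flip y (f j) (f i)] = flip [ffun i => y (f i)] j.
Proof.
apply/ffunP=> i; rewrite flipE !ffunE (can_eq fK).
by case: eqP => [->|]; rewrite ?addbT ?addbF.
Qed.

Lemma stab_relabel psi : stab psi -> stab (relabel psi).
Proof.
elim=> [|j {}psi _ IH|j {}psi _ IH|c t {}psi ct _ IH].
- suff -> : relabel (ket [ffun => false]) = ket [ffun => false] by apply: stabG_ket0.
  apply/ffunP=> y; rewrite relabelE !ketE; congr (if _ then _ else _).
  apply/eqP/eqP=> [/ffunP e|->]; apply/ffunP=> j; rewrite !ffunE //.
  by have := e (g j); rewrite !ffunE gK.
- suff -> : relabel (hadamard j psi) = hadamard (f j) (relabel psi) by apply: stabG_H.
  by apply/ffunP=> y; rewrite relabelE !gateE !relabelE flip_relabel ffunE.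
- suff -> : relabel (phase j psi) = phase (f j) (relabel psi) by apply: stabG_S.
  by apply/ffunP=> y; rewrite relabelE !gateE !relabelE ffunE.
- suff -> : relabel (cnot c t psi) = cnot (f c) (f t) (relabel psi).
    by apply: stabG_CX; rewrite ?(can_eq fK).
  by apply/ffunP=> y; rewrite relabelE !gateE !relabelE flip_relabel ffunE.
Qed.

Lemma rank_le_relabel psi k : rank_le psi k -> rank_le (relabel psi) k.
Proof.
move=> [P [c [sP ->]]]; exists (relabel \o P), c; split=> [i|]; first exact: stab_relabel.
by apply/ffunP=> y; rewrite relabelE !ffunE; apply: eq_bigr => i _; rewrite relabelE.
Qed.

End Relabel.

(** * Tensor products of states *)

Section Tensor.
Variables I J : finType.

Definition tensor (Phi : I -> amp J) : amp (I * J)%type :=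
  [ffun y : word (I * J)%type => \prod_i Phi i [ffun j => y (i, j)]].

Lemma tensorE Phi (y : word (I * J)%type) : tensor Phi y = \prod_i Phi i [ffun j => y (i, j)].
Proof. by rewrite ffunE. Qed.

Lemma flip_slice (y : word (I * J)%type) i j i' :
  [ffun k => flip y (i, j) (i', k)] =
  if i' == i then flip [ffun k => y (i, k)] j else [ffun k => y (i', k)].
Proof.
case: eqP => [->|/eqP ne]; apply/ffunP=> k; rewrite ?flipE !ffunE xpair_eqE.
  by rewrite eqxx /=; case: eqP => [->|]; rewrite ?addbT ?addbF.
by rewrite (negbTE ne).
Qed.

Definition tensor1 (Phi : I -> amp J) i psi := tensor (fun k => if k == i then psi else Phi k).

Lemma tensor1E Phi i psi (y : word (I * J)%type) : tensor1 Phi i psi y =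
  psi [ffun j => y (i, j)] * \prod_(k | k != i) Phi k [ffun j => y (k, j)].
Proof.
rewrite tensorE (bigD1 i) //= eqxx; congr (_ * _).
by apply: eq_bigr => k ne; rewrite (negbTE ne).
Qed.

Lemma tensor1_flip Phi i j psi (y : word (I * J)%type) :
  tensor1 Phi i psi (flip y (i, j)) =
  psi (flip [ffun j => y (i, j)] j) * \prod_(k | k != i) Phi k [ffun j => y (k, j)].
Proof.
rewrite tensor1E flip_slice eqxx; congr (_ * _).
by apply: eq_bigr => k ne; rewrite flip_slice (negbTE ne).
Qed.

(** Induction on the circuit of [psi]: a gate on qubit [j] of factor [i] is the gate on qubit
    [(i, j)] of the product. *)
Lemma stab_tensor1 (Phi : I -> amp J) i psi :
  stab (tensor1 Phi i (ket [ffun => false])) -> stab psi -> stab (tensor1 Phi i psi).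
Proof.
move=> s0; elim=> [//|j {}psi _|j {}psi _|c t {}psi ct _] sT.
- suff -> : tensor1 Phi i (hadamard j psi) = hadamard (i, j) (tensor1 Phi i psi).
    exact: stabG_H.
  apply/ffunP=> y; rewrite tensor1E !gateE tensor1_flip tensor1E ffunE.
  by case: (y (i, j)); ring.
- suff -> : tensor1 Phi i (phase j psi) = phase (i, j) (tensor1 Phi i psi).
    exact: stabG_S.
  by apply/ffunP=> y; rewrite tensor1E !gateE tensor1E ffunE mulrA.
- suff -> : tensor1 Phi i (cnot c t psi) = cnot (i, c) (i, t) (tensor1 Phi i psi).
    by apply: stabG_CX; rewrite // xpair_eqE eqxx.
  apply/ffunP=> y; rewrite tensor1E !gateE tensor1_flip tensor1E ffunE.
  by case: (y (i, c)).
Qed.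

(** Factors are switched from |0...0> to [Phi i] one at a time. *)
Lemma stab_tensor (Phi : I -> amp J) : (forall i, stab (Phi i)) -> stab (tensor Phi).
Proof.
move=> sP.
suff st (s : seq I) : stab (tensor (fun i => if i \in s then Phi i else ket [ffun => false])).
  suff -> : tensor Phi =
      tensor (fun i => if i \in enum I then Phi i else ket [ffun => false]) by [].
  by apply/ffunP=> y; rewrite !tensorE; apply: eq_bigr => i _; rewrite mem_enum.
elim: s => [|j s IH].
  suff -> : tensor (fun i => if i \in [::] then Phi i else ket [ffun => false])
     = ket [ffun => false] by apply: stabG_ket0.
  apply/ffunP=> y; rewrite tensorE ketE; case: eqP => [->|ne].
    rewrite big1 // => i _; rewrite ketE; case: eqP => // n; case: n.
    by apply/ffunP=> j; rewrite !ffunE.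
  have [[i j] yij] : exists p, y p.
    apply/existsP; apply: contra_notT ne; rewrite negb_exists => /forallP n.
    by apply/ffunP=> p; rewrite ffunE (negbTE (n p)).
  rewrite (bigD1 i) //= ketE; case: eqP => [/ffunP/(_ j)|]; last by rewrite mul0r.
  by rewrite !ffunE yij.
have [js|js] := boolP (j \in s).
  move: IH; congr (stab _); apply/ffunP=> y; rewrite !tensorE; apply: eq_bigr => i _.
  by rewrite inE; case: eqP => [->|//]; rewrite js.
suff <- : tensor1 (fun k => if k \in s then Phi k else ket [ffun => false]) j (Phi j)
   = tensor (fun i => if i \in j :: s then Phi i else ket [ffun => false]).
  apply: stab_tensor1 => //; move: IH; congr (stab _).
  apply/ffunP=> y; rewrite !tensorE; apply: eq_bigr => i _.
  by case: eqP => [->|//]; rewrite (negbTE js).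
by apply/ffunP=> y; rewrite !tensorE; apply: eq_bigr => i _; rewrite inE; case: eqP => [->|].
Qed.

(** Expanding the product of sums gives one product of stabilizer states for each map from [I] to
    ['I_k]. *)
Lemma rank_le_tensor psi k : rank_le psi k -> rank_le (tensor (fun _ => psi)) (k ^ #|I|).
Proof.
move=> [P [c [sP ->]]].
have -> : (k ^ #|I| = #|{ffun I -> 'I_k}|)%N by rewrite card_ffun card_ord.
apply: (@rank_le_fin _ _ (fun u : {ffun I -> 'I_k} => tensor (fun i => P (u i)))
                     (fun u : {ffun I -> 'I_k} => \prod_i c (u i))).
  by move=> u; apply: stab_tensor.
move=> y; rewrite tensorE.
under eq_bigr do rewrite ffunE.
rewrite bigA_distr_bigA; apply: eq_bigr => u _.
by rewrite tensorE -big_split.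
Qed.

End Tensor.

(** * Code states and gluing *)

Lemma omega_sqr : omega * omega = 'i.
Proof. by rewrite /omega -/rt2; ring: rt2_sqr iMi. Qed.

(* The amplitudes of the magic basis: [hat b] is |T> for b = 0, |T^perp> for b = 1. *)
Definition hat (b c : bool) : algC := rt2 * (if c then (if b then - omega else omega) else 1).

Lemma hat_flip b c : hat (~~ b) c = (if c then -1 else 1) * hat b c.
Proof. by rewrite /hat; case: b; case: c => /=; ring. Qed.

(* The Clifford operator SX is diagonal in the magic basis. *)
Lemma hat_eigen b c :
  (if c then 'i else 1) * hat b (~~ c) = (if b then - omega else omega) * hat b c.
Proof. by rewrite /hat; case: b; case: c => /=; ring: omega_sqr. Qed.

(* The bra <00| - i<11| tests equality in the magic basis. *)
Lemma hat_glue b b' :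
  hat b false * hat b' false + - 'i * (hat b true * hat b' true) = (b == b')%:R.
Proof.
rewrite /hat; case: b; case: b' => /=; rewrite ?eqxx;
  ring: omega_sqr iMi rt2_sqr.
Qed.

(** Unnormalised. Words are given by coordinate functions on an index type [V], so removing qubits
    leaves [V] alone, and distinct indices may come to carry the same word. *)
Definition code_state (V I : finType) (C : {set V}) (h : I -> V -> bool) : amp I :=
  [ffun y : word I => \sum_(v in C) \prod_i hat (h i v) (y i)].

Definition magic_state (I : finType) : amp I := [ffun y : word I => \prod_i hat false (y i)].

Lemma code_stateE (V I : finType) (C : {set V}) (h : I -> V -> bool) (y : word I) :
  code_state C h y = \sum_(v in C) \prod_i hat (h i v) (y i).
Proof. by rewrite ffunE. Qed.

Lemma big_option_prod (I : finType) (F : option I -> algC) :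
  \prod_o F o = F None * \prod_i F (Some i).
Proof.
rewrite (bigD1 None) //=; congr (_ * _).
rewrite (reindex_omap Some id) /=; last by case.
by apply: eq_bigl => i; rewrite eqxx.
Qed.

Lemma prod_hat_ext (I : finType) (b : option (option I) -> bool) c d (y : word I) :
  \prod_o hat (b o) (ext c (ext d y) o) =
  hat (b None) c * (hat (b (Some None)) d * \prod_i hat (b (Some (Some i))) (y i)).
Proof.
rewrite !big_option_prod !extE; congr (_ * (_ * _)).
by apply: eq_bigr => i _; rewrite !extE.
Qed.

Section CodeState.
Variable V : finType.
Implicit Types C : {set V}.

(** By [hat_flip], Z on a qubit exchanges |T> and |T^perp> and so complements that coordinate of
    every word. *)
Lemma rank_le_code_flip (I : finType) C (h : I -> V -> bool) (b : word I) k :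
  rank_le (code_state C h) k -> rank_le (code_state C (fun i v => h i v (+) b i)) k.
Proof.
move=> r.
suff st (s : seq I) : rank_le (code_state C (fun i v => h i v (+) ((i \in s) && b i))) k.
  move: (st (enum I)); congr rank_le; apply/ffunP=> y; rewrite !code_stateE.
  by apply: eq_bigr => v _; apply: eq_bigr => i _; rewrite mem_enum.
elim: s => [|j s IH].
  move: r; congr rank_le; apply/ffunP=> y; rewrite !code_stateE.
  by apply: eq_bigr => v _; apply: eq_bigr => i _; rewrite addbF.
have [js|js] := boolP ((j \notin s) && b j); last first.
  move: IH; congr rank_le; apply/ffunP=> y; rewrite !code_stateE.
  apply: eq_bigr => v _; apply: eq_bigr => i _; rewrite inE.
  by case: eqP => [->|//]; move: js; case: (j \in s); case: (b j).
move: (rank_le_Z j IH); congr rank_le; apply/ffunP=> y; rewrite pauliZE !code_stateE.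
rewrite mulr_sumr; apply: eq_bigr => v _.
rewrite (bigD1 j) // [RHS](bigD1 j) //= mulrA -hat_flip inE eqxx.
case/andP: js => /negbTE-> -> /=; rewrite addbF addbT; congr (_ * _).
by apply: eq_bigr => i ne; rewrite inE (negbTE ne).
Qed.

Lemma rank_le_code_relabel (I J : finType) C (h : I -> V -> bool) (f : I -> J) (g : J -> I) k :
  cancel f g -> cancel g f ->
  rank_le (code_state C h) k -> rank_le (code_state C (fun j => h (g j))) k.
Proof.
move=> fK gK /(rank_le_relabel fK gK); congr rank_le.
apply/ffunP=> y; rewrite relabelE !code_stateE; apply: eq_bigr => v _.
rewrite (reindex g) /=; last by exists f => ? _.
by apply: eq_bigr => j _; rewrite ffunE gK.
Qed.

Lemma rank_le_glue_None (I : finType) C (h : option (option I) -> V -> bool) k :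
  rank_le (code_state C h) k ->
  rank_le (code_state [set v in C | h None v == h (Some None) v]
                      (fun i => h (Some (Some i)))) k.
Proof.
move=> r.
(* After the CNOT, projecting [None] on |0> keeps the amplitudes at which the two qubits agree; the
   survivor of the two becomes the new [None]. *)
have /rank_le_half r1 := @rank_le_CX _ (Some None) None _ _ isT r.
(* Three phase gates put -i on |1>. The Hadamard and the projection on |0> then add both amplitudes,
   and the scalar [sqrtC 2] undoes the normalisation: this is the bra of [hat_glue]. *)
do 3!move/(rank_le_S None): r1 => r1.
move/(rank_le_H None)/rank_le_half/(rank_le_scal (sqrtC 2)): r1; congr rank_le.
apply/ffunP=> y; rewrite !(gateE, extE) /= ?mulr1 ?mul1r.
have rt2E : sqrtC 2 * rt2 = 1 by rewrite /rt2 mulfV // sqrtC_eq0 pnatr_eq0.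
rewrite mulrA rt2E mul1r !mulrA iMi mulN1r !code_stateE mulr_sumr -big_split /=.
rewrite [RHS]big_mkcond [LHS]big_mkcond; apply: eq_bigr => v _; rewrite inE.
case: (v \in C) => //=; rewrite !prod_hat_ext.
set p := \prod_i _; transitivity ((h None v == h (Some None) v)%:R * p).
  by rewrite -hat_glue; ring.
by case: eqP => _; rewrite ?mul1r ?mul0r.
Qed.

(** Renaming brings [i] and [j] to the positions [None] and [Some None]. *)
Lemma rank_le_glue (I : finType) C (h : I -> V -> bool) (i j : I) k : i != j ->
  rank_le (code_state C h) k ->
  exists (I' : finType) (h' : I' -> V -> bool), #|I| = #|I'|.+2 /\
    rank_le (code_state [set v in C | h i v == h j v] h') k.
Proof.
move=> ij r; pose I' : finType := {l : I | (l != i) && (l != j)}.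
pose g (o : option (option I')) :=
  match o with None => i | Some None => j | Some (Some u) => val u end.
have g_inj : injective g.
  move=> [[[u pu]|]|] [[[w pw]|]|] //= E; do ?[congr Some]; try exact: val_inj.
  - by exfalso; case/andP: (pu) => _; rewrite E eqxx.
  - by exfalso; case/andP: (pu); rewrite E eqxx.
  - by exfalso; case/andP: (pw) => _; rewrite -E eqxx.
  - by exfalso; move: ij; rewrite E eqxx.
  - by exfalso; case/andP: (pw); rewrite -E eqxx.
  - by exfalso; move: ij; rewrite E eqxx.
have cardI : #|I| = #|I'|.+2.
  rewrite card_sig -(cardC (pred2 i j)) card2 ij addnC addn2; congr _.+2.
  by apply: eq_card => l; rewrite !inE negb_or.
have [f fK gK] : bijective g by apply: inj_card_bij => //; rewrite cardI !card_option.
exists I', (fun u => h (val u)); split=> //.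
exact: (rank_le_glue_None (rank_le_code_relabel gK fK r)).
Qed.

(* If all qubits agree, the state is a T^I + b T^perp^I; adding its image under the
   Clifford SX / omega on one qubit cancels the second term. *)
Lemma rank_le_code_const (I : finType) C (h : I -> V -> bool) (i0 : I) (v0 : V) k :
  v0 \in C -> h i0 v0 = false -> (forall i v, v \in C -> h i v = h i0 v) ->
  rank_le (code_state C h) k -> rank_le (magic_state I) (k + k).
Proof.
move=> v0C hv0 hE r.
have := rank_le_add r (rank_le_scal omega^-1 (rank_le_S i0 (rank_le_X i0 r))).
(* Each all-T word is counted twice, once in the state and once in its image. *)
pose a : algC := #|[set v in C | ~~ h i0 v]|%:R * 2.
have a0 : a != 0.
  rewrite mulf_neq0 // pnatr_eq0 // cards_eq0; apply/set0Pn; exists v0.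
  by rewrite inE v0C hv0.
have w0 : omega != 0.
  by apply: contraNneq (neq0Ci algC) => w; rewrite -omega_sqr w mul0r.
move/(rank_le_scal a^-1); congr rank_le; apply/ffunP=> y.
rewrite !(gateE, paddE) !code_stateE ffunE.
apply: (canLR (mulKf a0)); rewrite mulr_sumr mulr_sumr -big_split /=.
rewrite /a -mulrA mulr_natl -sumr_const [RHS]big_mkcond [LHS]big_mkcond /=.
apply: eq_bigr => v _; rewrite inE; case: (boolP (v \in C)) => //= vC.
rewrite !(bigD1 i0 (P := xpredT)) //= !flipE eqxx addbT.
set p := \prod_(i | _) _; set p' := \prod_(i | _) _; set p'' := \prod_(i | _) _.
have -> : p' = p by apply: eq_bigr => i ne; rewrite flipE (negbTE ne) addbF.
rewrite [(if y i0 then _ else _) * _]mulrA hat_eigen.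
(* On |T^perp> the eigenvalue is [- omega], so the two contributions cancel; on |T> they
   coincide. *)
case: (boolP (h i0 v)) => hv /=.
  by rewrite !mulrA mulrN mulVf // !mulNr !mul1r subrr.
have -> : p'' = p by apply: eq_bigr => i ne; rewrite hE // (negbTE hv).
by rewrite -[omega * _ * p]mulrA mulKf //; ring.
Qed.

End CodeState.

(** Induction on [d]: each gluing costs two qubits and halves the bound on the number of words. The
    process stops early if every remaining word is constant. *)
Lemma rank_le_collapse (V : finType) d t (I : finType) (C : {set V}) (h : I -> V -> bool) k :
  C != set0 -> (#|C| <= 2 ^ d)%N -> (0 < t)%N -> (t + 2 * d <= #|I|)%N ->
  rank_le (code_state C h) k ->
  exists I' : finType, (t <= #|I'|)%N /\ rank_le (magic_state I') (k + k).
Proof.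
move=> C0 + t0; elim: d I C h C0 => [|d IH] I C h /set0Pn[v0 v0C] Cd It r.
  have /card_gt0P[i0 _] : (0 < #|I|)%N by apply: leq_trans It; rewrite addn_gt0 t0.
  exists I; split; first by apply: leq_trans It; rewrite leq_addr.
  have C1 v : v \in C -> v = v0.
    move=> vC; apply/eqP/negPn/negP=> ne; move: Cd; rewrite expn0 leqNgt => /negP; apply.
    by apply: (leq_trans _ (subset_leq_card (_ : [set v; v0] \subset C)));
      rewrite ?cards2 ?ne // subUset !sub1set vC.
  apply: (rank_le_code_const (i0 := i0) v0C _ _ (rank_le_code_flip [ffun i => h i v0] r)).
    by rewrite ffunE addbb.
  by move=> i v /C1->; rewrite !ffunE !addbb.
(* Complementing coordinates makes the word of [v0] zero, so [v0] survives when two coordinates are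
   equated. *)
have {r} := rank_le_code_flip [ffun i => h i v0] r; set h' := fun i v => _ => r.
have hv0 i : h' i v0 = false by rewrite /h' ffunE addbb.
have I0 : (0 < #|I|)%N by apply: leq_trans It; rewrite addn_gt0 t0.
have glue (g : I -> V -> bool) i j : i != j -> rank_le (code_state C g) k ->
    [set v in C | g i v == g j v] != set0 -> (#|[set v in C | g i v == g j v]| <= 2 ^ d)%N ->
    exists I' : finType, (t <= #|I'|)%N /\ rank_le (magic_state I') (k + k).
  move=> ij rg n0 card; have [I' [g' [cI r']]] := rank_le_glue ij rg.
  by apply: IH r' => //; move: It; rewrite cI mulnS addnCA add2n !ltnS.
have [/existsP[i /existsP[j /existsP[v /andP[vC hij]]]]|] :=
  boolP [exists i, exists j, exists v, (v \in C) && (h' i v != h' j v)].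
  have ij : i != j by apply: contraNneq hij => ->.
  pose E := [set v in C | h' i v == h' j v]; pose D := [set v in C | h' i v != h' j v].
  have cED : (#|E| + #|D| <= 2 ^ d + 2 ^ d)%N.
    rewrite addnn -mul2n -expnS; apply: leq_trans Cd.
    rewrite -(cardsID [set v | h' i v == h' j v] C) leq_add //.
      by apply/subset_leq_card/subsetP=> u; rewrite !inE.
    by apply/subset_leq_card/subsetP=> u; rewrite !inE andbC.
  (* [E] and [D] partition [C], so one of them has at most 2^d elements. *)
  have [Ed|Ed] := leqP #|E| (2 ^ d).
    by apply: glue ij r _ Ed; apply/set0Pn; exists v0; rewrite inE v0C !hv0.
  have Dd : (#|D| <= 2 ^ d)%N.
    by rewrite -(leq_add2l (2 ^ d)) (leq_trans _ cED) // leq_add2r ltnW.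
  (* Complementing coordinate [j] makes the gluing keep [D] in place of [E]. *)
  have := rank_le_code_flip [ffun l => l == j] r; set g := fun l u => _ => rg.
  have DE : [set v in C | g i v == g j v] = D.
    apply/setP=> u; rewrite !inE /g !ffunE eqxx (negbTE ij) addbF addbT.
    by case: (h' i u); case: (h' j u).
  apply: glue ij rg _ _; rewrite DE //.
  by apply/set0Pn; exists v; rewrite inE vC hij.
rewrite negb_exists => /forallP n.
have [i0 _] := card_gt0P I0.
exists I; split; first by apply: leq_trans It; rewrite leq_addr.
apply: (rank_le_code_const v0C (hv0 i0) _ r) => i v vC; apply/eqP.
move: (n i); rewrite negb_exists => /forallP/(_ i0); rewrite negb_exists => /forallP/(_ v).
by rewrite vC /= negbK.
Qed.

(** * Tensor powers of |T> on a prescribed number of qubits *)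

Lemma rank_le_magic_card (I J : finType) k : #|I| = #|J| ->
  rank_le (magic_state I) k -> rank_le (magic_state J) k.
Proof.
move=> e; pose f i : J := enum_val (cast_ord e (enum_rank i)).
pose g j : I := enum_val (cast_ord (esym e) (enum_rank j)).
have fK : cancel f g by move=> i; rewrite /f /g enum_valK cast_ordK enum_rankK.
have gK : cancel g f by move=> i; rewrite /f /g enum_valK cast_ordKV enum_rankK.
move/(rank_le_relabel fK gK); congr rank_le; apply/ffunP=> y.
rewrite relabelE !ffunE (reindex g) /=; last by exists f => ? _.
by apply: eq_bigr => j _; rewrite ffunE gK.
Qed.

(** Since <0|T> = 1/sqrt 2 is nonzero, projecting a qubit on |0> leaves |T> on the others up to a
    scalar. *)
Lemma rank_le_magic_option (I : finType) k :
  rank_le (magic_state (option I)) k -> rank_le (magic_state I) k.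
Proof.
move=> /rank_le_half/(rank_le_scal (sqrtC 2)); congr rank_le.
apply/ffunP=> y; rewrite scalE halfE !ffunE big_option_prod ext_None.
rewrite /hat mulr1 mulrA /rt2 mulfV ?sqrtC_eq0 ?pnatr_eq0 // mul1r.
by apply: eq_bigr => i _; rewrite ext_Some.
Qed.

Lemma rank_le_magic_le (I : finType) n k : (n <= #|I|)%N ->
  rank_le (magic_state I) k -> rank_le (magic_state 'I_n) k.
Proof.
move=> /subnK e r.
have {r} : rank_le (magic_state 'I_(#|I| - n + n)) k.
  by apply: rank_le_magic_card r; rewrite card_ord e.
elim: (#|I| - n)%N => [//|l IH r]; apply/IH/rank_le_magic_option.
by apply: rank_le_magic_card r; rewrite card_option !card_ord.
Qed.

(** * Stabilizer ranks of code states and of powers of |T> *)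

Lemma stabilizerP n (psi : state n) : stabilizer psi <-> stab psi.
Proof.
split; elim=> [|j chi _|j chi _|c t chi ct _].
- exact: stabG_ket0.
- exact: stabG_H.
- exact: stabG_S.
- exact: stabG_CX.
- exact: stab_ket0.
- exact: stab_H.
- exact: stab_S.
- exact: stab_CX.
Qed.

Lemma rank_leP n (psi : state n) k : stab_decomp psi k <-> rank_le psi k.
Proof. by split=> [] [P [c [sP e]]]; exists P, c; split=> // i; apply/stabilizerP. Qed.

Lemma stab_rank_le n (psi : state n) k : rank_le psi k -> (stab_rank psi <= k)%N.
Proof.
move=> /rank_leP r; rewrite /stab_rank; case: pselect => [ex|//].
by case: ex_minnP => l _; apply; apply/asboolP.
Qed.

Lemma rank_le_stab_rank n (psi : state n) : rank_le psi (stab_rank psi).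
Proof.
apply/rank_leP; rewrite /stab_rank; case: pselect => [ex|nex].
  by case: ex_minnP => l /asboolP.
by have [k /rank_leP r] := rank_le_finite psi; case: nex; exists k.
Qed.

(** Expanding [r] copies of the code state gives a sum over [r]-tuples of codewords. Each copy is
    first scaled by [sqrtC 2 ^+ \dim L] to remove its normalisation. *)
Lemma rank_le_code_power m (L : {vspace 'rV['F_2]_m}) r :
  rank_le (code_state [set f : {ffun 'I_r -> 'rV['F_2]_m} | f \in ffun_on (mem L)]
             (fun (ij : 'I_r * 'I_m) f => f ij.1 0 ij.2 == 1))
          (stab_rank (Lhat L) ^ r).
Proof.
have := rank_le_scal (sqrtC 2 ^+ \dim L) (rank_le_stab_rank (Lhat L)).
move/(rank_le_tensor 'I_r); rewrite card_ord; congr rank_le; apply/ffunP=> y.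
rewrite tensorE code_stateE.
under eq_bigr => i _.
  rewrite scalE ffunE mulrA mulfV ?expf_neq0 ?sqrtC_eq0 ?pnatr_eq0 // mul1r.
  over.
rewrite bigA_distr_big; apply: eq_big => f; first by rewrite inE.
move=> _; under eq_bigr do rewrite ffunE.
rewrite pair_big; apply: eq_bigr => -[i j] _.
by rewrite ffunE.
Qed.

(** The tuples number 2^(r dim L), so at most 2 r dim L of the r m qubits are spent in collapsing
    them. *)
Lemma stab_rank_Tpow_le m (L : {vspace 'rV['F_2]_m}) r :
  (0 < r)%N -> (2 * \dim L < m)%N ->
  (stab_rank (Tpow (r * (m - 2 * \dim L))) <= 2 * stab_rank (Lhat L) ^ r)%N.
Proof.
move=> r0 km.
have [||||I [tI]] := @rank_le_collapse _ (\dim L * r) (r * (m - 2 * \dim L)) _ _ _ _ _ _ _ _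
  (rank_le_code_power L r).
- by apply/set0Pn; exists 0; rewrite inE; apply/ffun_onP=> i; rewrite ffunE mem0v.
- by rewrite cardsE card_ffun_on card_ord card_vspace card_Fp // expnM.
- by rewrite muln_gt0 r0 subn_gt0.
- by rewrite card_prod !card_ord (mulnA 2) (mulnC _ r) -mulnDr subnK // ltnW.
(* Surplus qubits are discarded; on an ordinal, [magic_state] is [Tpow] by computation. *)
by rewrite addnn -mul2n => /(rank_le_magic_le tI)/stab_rank_le.
Qed.

(** * Comparison of growth rates *)

Section Growth.
Variable R : realType.

Lemma bernoulli_ge (b : R) q : 1 <= b -> q%:R * (b - 1) <= b ^+ q.
Proof.
move=> b1; suff : 1 + q%:R * (b - 1) <= b ^+ q.
  by apply: le_trans; rewrite lerDr ler01.
elim: q => [|q IH]; first by rewrite mul0r addr0.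
have b0 : 0 <= b by apply: le_trans b1.
rewrite exprS; apply: le_trans (ler_wpM2l b0 IH).
have : 0 <= q%:R * (b - 1) * (b - 1) by rewrite !mulr_ge0 ?subr_ge0.
rewrite -subr_ge0 -[in X in _ -> X]subr_ge0 subr0; congr (0 <= _).
by rewrite -natr1; ring.
Qed.

Lemma horner_le_pow (p : {poly R}) (x : R) : 1 <= x ->
  p.[x] <= (\sum_(i < size p) `|p`_i|) * x ^+ size p.
Proof.
move=> x1; rewrite horner_coef mulr_suml; apply: ler_sum => i _.
apply: le_trans (ler_norm _) _; rewrite normrM ler_wpM2l // ger0_norm ?exprn_ge0 //.
  by rewrite ler_weXn2l // ltnW.
exact: le_trans x1.
Qed.

(** With r = (d+1) q, Bernoulli's inequality bounds b^r below by (q (b-1))^(d+1), of degree d+1 in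
    q, while the polynomial is at most a constant times q^d. *)
Lemma exp_beats_poly (p : {poly R}) (b c : R) (N : nat) : 1 < b -> 0 < c ->
  exists2 r, (N <= r)%N & p.[r%:R] < c * b ^+ r.
Proof.
move=> b1 c0; set d := size p; pose A := \sum_(i < size p) `|p`_i|.
have A0 : 0 <= A by apply: sumr_ge0.
have b10 : 0 < b - 1 by rewrite subr_gt0.
(* The value that q must exceed once q^d is cancelled from both sides. *)
pose K := A * d.+1%:R ^+ d / (c * (b - 1) ^+ d.+1).
have cb0 : 0 < c * (b - 1) ^+ d.+1 by rewrite mulr_gt0 ?exprn_gt0.
have K0 : 0 <= K by rewrite divr_ge0 ?mulr_ge0 ?exprn_ge0 // ltW.
pose q := (Num.bound K + N).+1.
have Kq : K < q%:R.
  by apply: lt_le_trans (archi_boundP K0) _; rewrite ler_nat /q -addnS leq_addr.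
exists (d.+1 * q)%N; first by rewrite /q -addSn mulSn (leq_trans _ (leq_addr _ _)) // leq_addl.
apply: le_lt_trans (horner_le_pow p _) _; first by rewrite ler1n.
have -> : b ^+ (d.+1 * q) = (b ^+ q) ^+ d.+1 by rewrite mulnC exprM.
rewrite -/A -/d.
apply: (@lt_le_trans _ _ (c * (q%:R * (b - 1)) ^+ d.+1)); last first.
  apply: ler_wpM2l; first exact: ltW.
  apply: lerXn2r; last by apply: bernoulli_ge; apply: ltW.
    by rewrite nnegrE mulr_ge0 // ltW.
  by rewrite nnegrE exprn_ge0 // ltW // (lt_trans ltr01).
have q0 : 0 < q%:R ^+ d :> R by rewrite exprn_gt0 // ltr0n.
have -> : A * (d.+1 * q)%:R ^+ d = A * d.+1%:R ^+ d * q%:R ^+ d.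
  by rewrite natrM exprMn mulrA.
have -> : c * (q%:R * (b - 1)) ^+ d.+1 = q%:R * (c * (b - 1) ^+ d.+1) * q%:R ^+ d.
  by rewrite exprMn [q%:R ^+ d.+1]exprS; ring.
by rewrite ltr_pM2r // -ltr_pdivrMr.
Qed.

End Growth.

Theorem theorem4 (R : realType) (p q : {poly R}) (gamma : R) :
  0 < gamma ->
  (exists c : R, 0 < c /\ exists N : nat, forall n : nat, (N <= n)%N ->
      0 < p.[n%:R] /\
      c * (2 `^ (gamma * n%:R) / p.[n%:R]) <= (stab_rank (Tpow n))%:R) ->
  (exists C : R, 0 < C /\ exists N : nat, forall n : nat, (N <= n)%N ->
      (stab_rank (Tpow n))%:R <= C * (q.[n%:R] * 2 `^ (gamma * n%:R))) ->
  forall (m k : nat) (L : {vspace 'rV['F_2]_m}),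
    \dim L = k -> (2 * k < m)%N ->
    gamma <= (ln (stab_rank (Lhat L))%:R / ln 2) / (m%:R - 2 * k%:R).
Proof.
move=> g0 [c [c0 [N H]]] _ m k L <- km; set X := stab_rank (Lhat L).
pose s := (m - 2 * \dim L)%N.
have s0 : (0 < s)%N by rewrite subn_gt0.
have -> : m%:R - 2 * (\dim L)%:R = s%:R :> R by rewrite natrB ?natrM // ltnW.
have ln2 : 0 < ln 2 :> R by rewrite ln_gt0 // ltr1n.
pose a : R := 2 `^ (gamma * s%:R).
have a0 : 0 < a by rewrite powR_gt0.
(* The lower bound at n = r s meets the upper bound from [r] copies of the code state. *)
have bound r : (0 < r)%N -> (N <= r)%N -> c * a ^+ r <= 2 * X%:R ^+ r * p.[(r * s)%:R].
  move=> r0 Nr; have [|p0 Hr] := H (r * s)%N; first by rewrite (leq_trans Nr) // leq_pmulr.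
  have -> : a ^+ r = 2 `^ (gamma * (r * s)%:R).
    by rewrite -powR_mulrn ?powR_ge0 // -powRrM natrM mulrAC mulrA.
  rewrite -ler_pdivrMr // -mulrA; apply: le_trans Hr _.
  by rewrite -natrX -natrM ler_nat; apply: stab_rank_Tpow_le.
(* A zero rank would contradict [bound]; positivity gives the logarithm its meaning. *)
have X0 : 0 < X%:R :> R.
  rewrite ltr0n lt0n; apply/eqP=> XE.
  have := bound N.+1 isT (leqnSn N); rewrite XE expr0n mulr0 mul0r.
  by rewrite leNgt mulr_gt0 // exprn_gt0.
rewrite ler_pdivlMr ?ltr0n // ler_pdivlMr //.
(* The claim has become [a <= X]. If it failed, the powers of a / X > 1 would outgrow a polynomial
   in [r]. *)
rewrite -ln_powR -/a ler_ln ?posrE // leNgt; apply/negP=> Xa.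
pose P := 2 *: (p \Po (s%:R *: 'X)).
(* Asking for [r] above [N] also makes it positive, as [bound] requires. *)
have [||r rN] := @exp_beats_poly R P (a / X%:R) c N.+1; rewrite ?ltr_pdivlMr ?mul1r //.
apply/negP; rewrite -leNgt /P hornerZ horner_comp hornerZ hornerX -natrM.
rewrite expr_div_n mulrA ler_pdivrMr ?exprn_gt0 // mulrAC mulnC.
exact: bound (leq_ltn_trans _ rN) (ltnW rN).
Qed.
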